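(* Let $\mathcal{A}$ be the set of admissible evader controls from the starting position $\mathbf{x}_S$ to the target $\mathbf{x}_T$, and let $\mathcal{J}_1,\dots,\mathcal{J}_r$ be the cumulative observabilities associated with the $r$ observer locations $\hat{\mathbf{x}}_1,\dots,\hat{\mathbf{x}}_r$. If $\mathbf{a}_{=}(\cdot)\in\mathcal{A}$ is a Pareto-optimal control satisfying $\mathcal{J}_i(\mathbf{a}_{=}(\cdot))=\mathcal{J}_j(\mathbf{a}_{=}(\cdot))$ for all $i,j\in\{1,\dots,r\}$, then $\mathbf{a}_{=}(\cdot)$ is also worst-case optimal, i.e. $$\max_{1\le i\le r}\mathcal{J}_i(\mathbf{a}_{=}(\cdot))\;\le\;\max_{1\le i\le r}\mathcal{J}_i(\mathbf{a}(\cdot))\qquad\text{for all }\mathbf{a}(\cdot)\in\mathcal{A}.$$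
   Context: Setting. $\Omega\subset\mathbb{R}^d$ is compact, $\mathbf{x}_S,\mathbf{x}_T\in\Omega$ are fixed (start and target of an evader), and $A=\{\mathbf{a}\in\mathbb{R}^d: |\mathbf{a}|=1\}$. A control is a measurable function $\mathbf{a}:\mathbb{R}\to A$; the evader's trajectory is $\mathbf{y}'(t)=f(\mathbf{y}(t))\,\mathbf{a}(t)$, $\mathbf{y}(0)=\mathbf{x}_S$, with $f$ a given speed function, and $T_{\mathbf{a}}=\min\{t\ge 0: \mathbf{y}(t)=\mathbf{x}_T\}$. $\mathcal{A}$ denotes the set of admissible controls, i.e. those with $T_{\mathbf{a}}<\infty$ and $\mathbf{y}(t)\in\Omega$ for all $t\in[0,T_{\mathbf{a}}]$. There are $r$ observer locations $\hat{\mathbf{x}}_1,\dots,\hat{\mathbf{x}}_r$; location $\hat{\mathbf{x}}_i$ has a positive pointwise observability function $K_i:\Omega\to(0,\infty)$, and the corresponding cumulative observability of a control is $$\mathcal{J}_i(\mathbf{a}(\cdot))=\int_0^{T_{\mathbf{a}}}K_i(\mathbf{y}(t))\,dt .$$ The functions $f$ and $K_i$ are understood to be regular enough that trajectories and these (finite) integrals are well defined. A control $\mathbf{a}(\cdot)\in\mathcal{A}$ is dominated by $\hat{\mathbf{a}}(\cdot)\in\mathcal{A}$ if $\mathcal{J}_i(\hat{\mathbf{a}}(\cdot))\le\mathcal{J}_i(\mathbf{a}(\cdot))$ for all $i$, with strict inequality for at least one $i$. A control is Pareto optimal if it is not dominated by any other control in $\mathcal{A}$. *)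

(* Defs.v *)
From HB Require Import structures.
From mathcomp Require Import all_boot all_order all_algebra.
From mathcomp Require Import all_classical all_reals all_analysis.
Set Implicit Arguments.
Unset Strict Implicit.
Unset Printing Implicit Defensive.
Import Order.TTheory GRing.Theory Num.Theory.
Import numFieldNormedType.Exports.

Local Open Scope classical_set_scope.
Local Open Scope ring_scope.

(* The norm of the normed module 'rV[R]_d is the sup norm. *)
Definition eucl_norm (R : realType) (d : nat) (x : 'rV[R]_d) : R :=
  Num.sqrt (\sum_(j < d) x 0 j ^+ 2).

(* The library's [measurableTypeR] carries the Borel sigma-algebra; the
   Lebesgue one is the Caratheodory sigma-algebra of the outer measure
   generated by interval length, on which [completed_lebesgue_measure] lives. *)
Definition Lebesgue_measurable (R : realType) (A : set R) : Prop :=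
  ((wlength (@idfun R))^*)%mu.-cara.-measurable A.

Definition absolutely_continuous_on (R : realType) (V : normedModType R)
    (a b : R) (y : R -> V) : Prop :=
  forall e : R, 0 < e -> exists2 delta : R, 0 < delta &
    forall (n : nat) (u v : 'I_n -> R),
      (forall i, a <= u i /\ u i <= v i /\ v i <= b) ->
      trivIset [set: 'I_n] (fun i => `]u i, v i[%classic) ->
      \sum_(i < n) (v i - u i) < delta ->
      \sum_(i < n) `|y (v i) - y (u i)| < e.

(* [speed] and [observability i] are total functions, but only the values of
   [observability i] on [domain] matter. The cost of the i-th observer depends
   on its location [observer i] only through [observability i]. *)
Record evasion_problem (R : realType) (d r : nat) := EvasionProblem {
  domain : set 'rV[R]_d ;
  start : 'rV[R]_d ;
  target : 'rV[R]_d ;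
  speed : 'rV[R]_d -> R ;
  observer : 'I_r -> 'rV[R]_d ;
  observability : 'I_r -> 'rV[R]_d -> R
}.

Section Evasion.
Context {R : realType} {d r : nat}.
Variable p : evasion_problem R d r.
Implicit Types (a : R -> 'rV[R]_d) (y : R -> 'rV[R]_d) (i : 'I_r).

Definition control a : Prop :=
  (forall U : set 'rV[R]_d, open U -> Lebesgue_measurable (a @^-1` U)) /\
  (forall t, eucl_norm (a t) = 1).

(* Controls are merely measurable, so y' = f(y) a, y(0) = x_S is understood in
   the Caratheodory sense. Values of y at negative times are irrelevant. *)
Definition is_trajectory a y : Prop :=
  [/\ y 0 = start p,
      forall t, 0 <= t -> absolutely_continuous_on 0 t y &
      {ae @completed_lebesgue_measure R, forall t : R, 0 < t ->
        is_derive t (1 : R) y (speed p (y t) *: a t)}].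

Definition trajectory a : R -> 'rV[R]_d := get (is_trajectory a).

(* The minimum of the (closed) set of times at which the trajectory is at the
   target, and +oo if there is none. *)
Definition arrival_time a : \bar R :=
  ereal_inf [set t%:E | t in [set t : R | 0 <= t /\ trajectory a t = target p]].

Definition travel_period a : set R :=
  [set t : R | 0 <= t /\ (t%:E <= arrival_time a)%E].

Definition admissible a : Prop :=
  [/\ control a, (arrival_time a < +oo)%E &
      forall t, travel_period a t -> domain p (trajectory a t)].

Definition cumulative_observability i a : \bar R :=
  (\int[@completed_lebesgue_measure R]_(t in travel_period a)
     (observability p i (trajectory a t))%:E)%E.

Definition well_posed_dynamics : Prop :=
  forall a, control a ->
    exists2 y, is_trajectory a y &
      forall z, is_trajectory a z -> forall t, 0 <= t -> z t = y t.

Definition finite_observabilities : Prop :=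
  forall i a, admissible a ->
    (@completed_lebesgue_measure R).-integrable (travel_period a)
      (fun t => (observability p i (trajectory a t))%:E).

Definition standing_assumptions : Prop :=
  [/\ compact (domain p),
      domain p (start p) /\ domain p (target p),
      forall i x, domain p x -> 0 < observability p i x,
      well_posed_dynamics &
      finite_observabilities].

Definition dominated_by a b : Prop :=
  (forall i, cumulative_observability i b <= cumulative_observability i a)%E /\
  (exists i, cumulative_observability i b < cumulative_observability i a)%E.

Definition Pareto_optimal a : Prop :=
  admissible a /\ ~ exists2 b, admissible b & dominated_by a b.

End Evasion.

(* Main.v *)
Require Import Defs.
From HB Require Import structures.
From mathcomp Require Import all_boot all_order all_algebra.
From mathcomp Require Import all_classical all_reals all_analysis.
Set Implicit Arguments.
Unset Strict Implicit.
Unset Printing Implicit Defensive.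
Import Order.TTheory GRing.Theory Num.Theory.

Local Open Scope ereal_scope.

(** If an admissible [a] had a strictly smaller worst case, each of its observabilities would lie
    below the maximum for [a_eq], which is the common value of all observabilities of [a_eq]. So [a]
    would be strictly better for every observer and would dominate [a_eq], against Pareto
    optimality. *)

Theorem theorem3p1 (R : realType) (d r : nat) (r_gt0 : (0 < r)%N)
    (p : evasion_problem R d r) (p_ok : standing_assumptions p)
    (a_eq : R -> 'rV[R]_d)
    (a_eq_adm : admissible p a_eq)
    (a_eq_Pareto : Pareto_optimal p a_eq)
    (a_eq_equal : forall i j : 'I_r,
       cumulative_observability p i a_eq = cumulative_observability p j a_eq) :
  forall a : R -> 'rV[R]_d, admissible p a ->
    \big[maxe/-oo]_(i < r) cumulative_observability p i a_eq <=
    \big[maxe/-oo]_(i < r) cumulative_observability p i a.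
Proof.
move=> a a_adm; case: a_eq_Pareto => _ undominated.
rewrite leNgt; apply/negP => max_lt; apply: undominated; exists a => //.
suff J_lt i :
    cumulative_observability p i a < cumulative_observability p i a_eq.
  (* Domination needs one strict index, and [r_gt0] supplies it. *)
  by split=> [i|]; [exact: ltW | exists (Ordinal r_gt0)].
apply: (le_lt_trans (le_bigmax -oo (cumulative_observability p ^~ a) i)).
apply: (lt_le_trans max_lt).
(* The maximum of a constant family is at most its value at [i]; the initial value [-oo] lies below
   everything. *)
by apply: bigmax_le => [|j _]; rewrite ?leNye // (a_eq_equal j i).
Qed.
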